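(* For all integers $n\ge 1$ and all $\alpha\in(0,1)$, $$\gamma(\alpha,n)\le \Big(\frac{n}{n+1}\Big)^{n+1}\cdot\frac{1}{\alpha n}.$$ Explicitly: for every integer $n\ge 1$, every $\alpha\in(0,1)$, every finite nonempty set $\Omega$ and every subset $A\subset\Omega^n$ with $\mu(A)=\alpha$, one has $$\mu(U(A))\le \Big(\frac{n}{n+1}\Big)^{n+1}\cdot\frac{1}{\alpha n}.$$
   Context: For a finite nonempty set $\Omega$ (the alphabet) and $n\ge 1$, $\mu=\mu_n$ denotes the uniform probability measure on $\Omega^n$, i.e. $\mu(A)=|A|/|\Omega|^n$. The shift map $s=s_m:\Omega^m\to\Omega^{m-1}$ is $s(w_1,\dots,w_m)=(w_2,\dots,w_m)$ (for each $m\ge 1$), and $s^j$ denotes its $j$-fold iterate, with $s^0$ the identity; so for $A\subset\Omega^n$ and $0\le j\le n-1$, $s^j(A)=\{(w_{j+1},\dots,w_n): (w_1,\dots,w_n)\in A\}\subset\Omega^{n-j}$. For $A\subset \Omega^n$ define $$U(A)=\Omega^n\setminus\bigcup_{j=0}^{n-1}\big(s^j(A)\times\Omega^j\big)\subset\Omega^n,$$ where $\Omega^{n-j}\times\Omega^j$ is identified with $\Omega^n$ by concatenation. Equivalently, $U(A)$ is the set of all $u=(u_1,\dots,u_n)\in\Omega^n$ such that for every $w=(w_1,\dots,w_n)\in A$ and every $j\in\{1,\dots,n\}$ one has $(w_{n-j+1},\dots,w_n)\ne(u_1,\dots,u_j)$ (no nonempty final segment of $w$ coincides with an initial segment of $u$).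 The quantity $\gamma(\alpha,n)$ is the largest possible value (supremum) of $\mu(U(A))$ over all finite nonempty sets $\Omega$ and all $A\subset\Omega^n$ with $\mu(A)=\alpha$. *)

(* Defs.v *)
From mathcomp Require Import all_boot all_order all_algebra.

Set Implicit Arguments.
Unset Strict Implicit.
Unset Printing Implicit Defensive.

Import Order.TTheory GRing.Theory Num.Theory.

Section Words.
Variable Omega : finType.

Definition shift (m : nat) (w : m.-tuple Omega) : m.-1.-tuple Omega :=
  behead_tuple w.

(* The j-fold iterate of shift; shift_iterS is the recursion s^(j+1) = s o s^j,
   stated on underlying sequences because n - j.+1 and (n - j).-1 are not
   convertible. *)
Definition shift_iter (n j : nat) (w : n.-tuple Omega) : (n - j).-tuple Omega :=
  drop_tuple j w.

Lemma shift_iter0 (n : nat) (w : n.-tuple Omega) :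
  shift_iter 0 w = w :> seq Omega.
Proof. exact: drop0. Qed.

Lemma shift_iterS (n j : nat) (w : n.-tuple Omega) :
  shift_iter j.+1 w = shift (shift_iter j w) :> seq Omega.
Proof. by rewrite /= -drop1 drop_drop add1n. Qed.

(* B x Omega^j inside Omega^n, for B a subset of Omega^(n-j): membership is
   equality of sequences with a concatenation, which avoids a cast from
   (n - j + j).-tuple to n.-tuple. *)
Definition cylinder (n j : nat) (B : {set (n - j).-tuple Omega}) :
    {set n.-tuple Omega} :=
  [set u : n.-tuple Omega |
    [exists v in B, exists x : j.-tuple Omega, tval u == tval v ++ tval x]]%SET.

Definition U (n : nat) (A : {set n.-tuple Omega}) : {set n.-tuple Omega} :=
  (~: \bigcup_(j < n) cylinder (@shift_iter n j @: A))%SET.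

Lemma in_UP (n : nat) (A : {set n.-tuple Omega}) (u : n.-tuple Omega) :
  reflect (forall w, w \in A -> forall j, 1 <= j <= n ->
             drop (n - j) w <> take j u)
          (u \in U A).
Proof.
rewrite in_setC; apply: (iffP negP) => [uU w wA j /andP[j0 jn] E | H].
  apply: uU; apply/bigcupP.
  have ltn : n - j < n by rewrite ltn_subrL j0 (leq_trans j0 jn).
  exists (Ordinal ltn) => //; rewrite inE; apply/existsP.
  exists (shift_iter (n - j) w); rewrite imset_f //=.
  have sx : size (drop j u) == n - j by rewrite size_drop size_tuple.
  by apply/existsP; exists (Tuple sx) => /=; rewrite E cat_take_drop.
case/bigcupP => j _; rewrite inE => /existsP[v /andP[/imsetP[w wA ->]]].
case/existsP => x /eqP /= E; apply: (H w wA (n - j)).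
  by rewrite subn_gt0 ltn_ord leq_subr.
by rewrite E (subKn (ltnW (ltn_ord j))) take_size_cat // size_drop size_tuple.
Qed.

End Words.

From mathcomp Require Import classical_sets reals.

Local Open Scope ring_scope.

Definition mu (R : realType) (Omega : finType) (n : nat)
    (A : {set n.-tuple Omega}) : R :=
  #|A|%:R / (#|Omega| ^ n)%:R.

(* The values lie in [0, 1]; when no A has measure alpha, sup yields 0. *)
Definition gamma (R : realType) (alpha : R) (n : nat) : R :=
  sup [set x : R | exists (Omega : finType) (A : {set n.-tuple Omega}),
         [/\ (0 < #|Omega|)%N, mu R A = alpha & x = mu R (U A)]]%classic.

(* Main.v *)
(* Enlarge A to the set A' of all words no nonempty final segment of which is
   an initial segment of a word of U(A); then U(A') = U(A). Let a, b be the
   measures of A' and U(A). In a random word, let E_t be the event that a word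
   of A' ends at position t and a word of U(A) starts right after it, and let
   F_k be the probability that none of k consecutive events E_t occurs. Since
   E_0 excludes E_1, ..., E_n,
     F_k - F_(k+1) = a P(U(A) at 0, no E_(n+1), ..., E_k).
   For d >= 1, "U(A) at 0" and "A' starting at d" are negatively correlated,
   whence the right-hand side is at least a b F_(k-n). A nonnegative sequence
   with F_0 = 1 and F_(k+1) <= F_k - c F_(k-n) forces
   c <= max_r r^n (1 - r) = (n/(n+1))^(n+1) / n: otherwise the bound on the
   ratios F_(k+1)/F_k would drop by a fixed amount every n steps. *)
Require Import Defs.
From mathcomp Require Import all_boot all_order all_algebra.
From mathcomp Require Import classical_sets reals.
From mathcomp Require Import ring lra zify.
Set Implicit Arguments.
Unset Strict Implicit.
Unset Printing Implicit Defensive.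

Import Order.TTheory GRing.Theory Num.Theory.
Local Open Scope ring_scope.

(** * Uniform averages over words of a given length *)

Section Average.
Variables (R : realFieldType) (Omega : finType).
Hypothesis Omega_gt0 : (0 < #|Omega|)%N.
Local Notation q := (#|Omega|%:R : R).

(** Averaging plain sequences letter by letter turns conditioning on a block and independence of
    blocks into uses of [avg_cat] and [avg_swap], with no casts between tuple lengths. *)
Fixpoint avg (N : nat) (F : seq Omega -> R) : R :=
  if N is M.+1 then q^-1 * \sum_x avg M (fun s => F (x :: s)) else F [::].

Definition pr (N : nat) (P : pred (seq Omega)) : R := avg N (fun s => (P s)%:R).

Lemma cardR_neq0 : q != 0.
Proof. by rewrite pnatr_eq0 -lt0n. Qed.

Lemma eq_avg N F G :
  (forall s, size s = N -> F s = G s) -> avg N F = avg N G.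
Proof.
elim: N F G => [|N IH] F G FG /=; first exact: FG.
by congr (_ * _); apply: eq_bigr => x _; apply: IH => s sN; rewrite FG //= sN.
Qed.

Lemma le_avg N F G :
  (forall s, size s = N -> F s <= G s) -> avg N F <= avg N G.
Proof.
elim: N F G => [|N IH] F G FG /=; first exact: FG.
rewrite ler_wpM2l ?invr_ge0 //; apply: ler_sum => x _.
by apply: IH => s sN; rewrite FG //= sN.
Qed.

Lemma avg_const N c : avg N (fun=> c) = c.
Proof.
elim: N => //= N IH; under eq_bigr do rewrite IH.
by rewrite sumr_const -[X in _ * X]mulr_natl mulrA mulVf ?mul1r // cardR_neq0.
Qed.

Lemma avgZ N c F : avg N (fun s => c * F s) = c * avg N F.
Proof.
elim: N F => //= N IH F; under eq_bigr do rewrite IH.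
by rewrite -mulr_sumr mulrCA.
Qed.

Lemma avgZr N c F : avg N (fun s => F s * c) = avg N F * c.
Proof. by rewrite mulrC -avgZ; apply: eq_avg => s _; rewrite mulrC. Qed.

Lemma avgB N F G : avg N (fun s => F s - G s) = avg N F - avg N G.
Proof.
elim: N F G => //= N IH F G; rewrite -mulrBr -sumrB.
by congr (_ * _); apply: eq_bigr => x _; rewrite IH.
Qed.

Lemma avg_cat M N F :
  avg (M + N) F = avg M (fun u => avg N (fun v => F (u ++ v))).
Proof. by elim: M F => //= M IH F; under eq_bigr do rewrite IH. Qed.

Lemma avg_sum N (F : Omega -> seq Omega -> R) :
  avg N (fun s => \sum_x F x s) = \sum_x avg N (F x).
Proof.
elim: N F => //= N IH F.
under eq_bigr do rewrite IH.
by rewrite exchange_big mulr_sumr.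
Qed.

Lemma avg_swap M N F :
  avg M (fun u => avg N (fun v => F u v)) =
  avg N (fun v => avg M (fun u => F u v)).
Proof.
elim: M F => //= M IH F; rewrite avgZ avg_sum.
by under eq_bigr do rewrite IH.
Qed.

Lemma pr_ge0 N P : 0 <= pr N P.
Proof. by rewrite -[0](avg_const N); apply: le_avg => s _; rewrite ler0n. Qed.

Lemma pr_take n M P : pr (n + M) (fun s => P (take n s)) = pr n P.
Proof.
rewrite /pr avg_cat; apply: eq_avg => u un.
by rewrite -[RHS](avg_const M); apply: eq_avg => v _; rewrite take_size_cat.
Qed.

Lemma pr_drop d N P : pr (d + N) (fun s => P (drop d s)) = pr N P.
Proof.
rewrite /pr avg_cat -[RHS](avg_const d); apply: eq_avg => u ud.
by apply: eq_avg => v _; rewrite drop_size_cat.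
Qed.

Lemma avg_tuple n F : avg n F = (q ^+ n)^-1 * \sum_(t : n.-tuple Omega) F t.
Proof.
elim: n F => [|n IH] F /=.
  rewrite expr0 invr1 mul1r (bigD1 [tuple]) //= big1 ?addr0 // => t /eqP[].
  exact: tuple0.
rewrite exprS invfM -mulrA; congr (_ * _).
under eq_bigr do rewrite IH.
rewrite -mulr_sumr; congr (_ * _); rewrite pair_big /=.
rewrite (reindex (fun t : n.+1.-tuple Omega => (thead t, behead_tuple t))) /=.
  by apply: eq_bigr => t _; rewrite [in RHS](tuple_eta t).
exists (fun p => cons_tuple p.1 p.2) => [t _|[x t] _] /=.
  by rewrite [RHS]tuple_eta; apply: val_inj.
by congr (_, _); apply: val_inj.
Qed.

Lemma pr_card n (A : {set n.-tuple Omega}) (P : pred (seq Omega)) :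
  (forall t : n.-tuple Omega, (t \in A) = P t) ->
  pr n P = #|A|%:R / (#|Omega| ^ n)%:R.
Proof.
move=> AP; rewrite /pr avg_tuple natrX mulrC; congr (_ / _).
rewrite -sum1_card natr_sum [RHS]big_mkcond /=.
by apply: eq_bigr => t _; rewrite AP; case: (P t).
Qed.
End Average.

(** * Overlaps between words of [A] and of [U A], and their negative correlation *)

Section Overlaps.
Variables (R : realFieldType) (Omega : finType) (n : nat).
Variable A : {set n.-tuple Omega}.
Hypothesis Omega_gt0 : (0 < #|Omega|)%N.
Hypothesis n_gt0 : (0 < n)%N.
Local Notation avg := (@avg R Omega).
Local Notation pr := (@pr R Omega).

Definition suffA (z : seq Omega) : bool := [exists w in A, suffix z w].

(** Words of every length are allowed so that a word can be revealed letter by letter; at length [n]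
    the negation is membership in [U A], by [in_U]. *)
Definition hitA (x : seq Omega) : bool :=
  [exists i : 'I_(size x), suffA (take i.+1 x)].

Definition prefU (z : seq Omega) : bool :=
  [exists u : n.-tuple Omega, ~~ hitA u && prefix z u].

(* The words of length n with hitU false form the largest set with the same U
   as A. *)
Fixpoint hitU (y : seq Omega) : bool :=
  if y is _ :: y' then prefU y || hitU y' else false.

Lemma hitAP x :
  reflect (exists2 i, 0 < i <= size x & suffA (take i x))%N (hitA x).
Proof.
apply: (iffP existsP) => [[i ix]|[[|i] // /andP[_ ix] h]].
  by exists i.+1 => //=; apply: ltn_ord.
by exists (Ordinal ix).
Qed.

Lemma hitA_cat x y : hitA x -> hitA (x ++ y).
Proof.
case/hitAP => i /andP[i0 ix] h; apply/hitAP; exists i.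
  by rewrite i0 size_cat (leq_trans ix) ?leq_addr.
by rewrite takel_cat.
Qed.

Lemma hitU_cat w z : z != [::] -> prefU z -> hitU (w ++ z).
Proof.
move=> z0 h; elim: w => [|x w IH] /=; last by rewrite IH orbT.
by case: z z0 h => //= x z _ ->.
Qed.

Lemma hitU_catr w z : hitU z -> hitU (w ++ z).
Proof. by move=> h; elim: w => //= x w ->; rewrite orbT. Qed.

Lemma in_U (u : n.-tuple Omega) : (u \in U A) = ~~ hitA u.
Proof.
apply/in_UP/idP => [H|/hitAP H w wA j /andP[j0 jn] E].
  apply/hitAP => -[i /andP[i0]]; rewrite size_tuple => iu.
  case/existsP => w /andP[wA /suffixP[s E]].
  apply: (H w wA i); first by rewrite i0.
  have sw : size (tval w) = n by rewrite size_tuple.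
  move: (sw); rewrite E size_cat size_takel ?size_tuple // => sE.
  have -> : (n - i)%N = size s by rewrite -[in LHS]sE addnK.
  by rewrite drop_size_cat.
apply: H; exists j; first by rewrite j0 size_tuple.
apply/existsP; exists w; rewrite wA /= -E; exact: suffix_drop.
Qed.

(* Suffixes of words of A never overlap prefixes of words of U A. *)
Lemma suffA_prefU z y r :
  z != [::] -> suffA (y ++ z) -> prefU (z ++ r) -> False.
Proof.
move=> z0 /existsP[w /andP[wA /suffixP[s E]]] /existsP[u /andP[/hitAP H]].
case/prefixP => r' E'; apply: H; exists (size z).
  by rewrite lt0n size_eq0 z0 E' -catA size_cat leq_addr.
apply/existsP; exists w; rewrite wA /= E' -catA take_size_cat // E.
by rewrite catA suffix_suffix.
Qed.

Lemma hitU_notin (w : n.-tuple Omega) : w \in A -> ~~ hitU w.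
Proof.
move=> wA; suff H y s : tval w = s ++ y -> ~~ hitU y by apply: (H w [::]).
elim: y s => //= x y IH s E; apply/norP; split; last first.
  by apply: (IH (rcons s x)); rewrite cat_rcons.
apply/negP => h; apply: (@suffA_prefU (x :: y) [::] [::]) => //=.
  by apply/existsP; exists w; rewrite wA E suffix_suffix.
by rewrite cats0.
Qed.

(* Once a suffix of a word of A ends inside e, no prefix of a word of U A
   starts before that end, so only the letters after it matter for hitU. *)
Lemma hit_correlation l (p r : seq Omega) (g : R) :
  (forall j, (j <= l)%N -> g <= pr j (fun e => ~~ hitU (e ++ r))) ->
  pr l (fun e => hitA (p ++ e)) * g <=
  pr l (fun e => hitA (p ++ e) && ~~ hitU (e ++ r)).
Proof.
elim: l p => [|l IH] p gle; have [hp|hp] := boolP (hitA p).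
- by move: (gle 0%N isT); rewrite /pr /= cats0 hp mul1r.
- by rewrite /pr /= cats0 (negbTE hp) mul0r.
- have E e : hitA (p ++ e) by apply: hitA_cat.
  rewrite /pr; under eq_avg do rewrite E.
  rewrite avg_const // mul1r; apply: le_trans (gle _ (leqnn _)) _.
  by apply: le_avg => e _; rewrite E.
rewrite /pr /= -mulrA ler_wpM2l ?invr_ge0 // mulr_suml.
apply: ler_sum => x _.
have := IH (rcons p x) (fun j jl => gle j (leqW jl)).
move/le_trans => H; rewrite (@eq_avg _ _ _ _ (fun e =>
  (hitA (rcons p x ++ e))%:R)); last by move=> e _; rewrite cat_rcons.
apply: H; apply: le_avg => e _; rewrite cat_rcons.
case: (boolP (hitA _)) => //= /hitAP[i /andP[i0 isz] h].
suff -> : prefU (x :: e ++ r) = false by [].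
case h': prefU => //; exfalso.
have ip : (size p < i)%N.
  rewrite ltnNge; apply: contra hp => ip; apply/hitAP; exists i.
    by rewrite i0.
  by move: h; rewrite takel_cat.
(* The forbidden overlap runs from [x] to the end of the suffix of a word of [A]: [x] and the next
   [i - size p - 1] letters. *)
rewrite -(cat_take_drop (i - size p).-1 e) in h'.
apply: (@suffA_prefU (x :: take (i - size p).-1 e) p
         (drop (i - size p).-1 e ++ r)) => //=; last by rewrite catA.
move: h; rewrite take_cat ltnNge (ltnW ip) /=.
by case: (i - size p)%N (subn_gt0 (size p) i) => [|k]; rewrite ip.
Qed.

Definition hitU_free_pr : R := pr n (fun w => ~~ hitU w).
Definition hitA_free_pr : R := pr n (fun u => ~~ hitA u).

Lemma prN N P : pr N (fun s => ~~ P s) = 1 - pr N P.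
Proof.
rewrite -[1](avg_const Omega_gt0 N) -avgB.
by apply: eq_avg => s _; case: (P s); rewrite ?subrr ?subr0.
Qed.

(** Disjoint blocks are independent. For [d < n], fix the [d] letters [p] before the overlap [c] and
    the [d] letters [r] after it; complementing [hitA] in [hit_correlation] gives the inequality
    over [c], and independence of [p] and [r] factors the bound. *)
Lemma U_A_correlation d :
  pr (d + n) (fun s => ~~ hitA (take n s) && ~~ hitU (drop d s))
  <= hitA_free_pr * hitU_free_pr.
Proof.
have [nd|dn] := leqP n d.
  have -> : hitA_free_pr = pr d (fun p => ~~ hitA (take n p)).
    rewrite -(subnKC nd).
    by rewrite (pr_take R Omega_gt0 n (d - n) (fun p => ~~ hitA p)).
  rewrite /hitU_free_pr /pr avg_cat -avgZr le_eqVlt.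
  apply/orP; left; apply/eqP/eq_avg => p pd.
  rewrite -avgZ; apply: eq_avg => r _.
  by rewrite takel_cat ?pd // drop_size_cat // -natrM mulnb.
have [l El] : exists l, n = (d + l)%N by exists (n - d)%N; lia.
have Eb : hitA_free_pr = avg d (fun p => pr l (fun c => ~~ hitA (p ++ c))).
  by rewrite /pr -(avg_cat d l (fun s => (~~ hitA s)%:R)) -El.
have Ea : hitU_free_pr = avg d (fun r => pr l (fun c => ~~ hitU (c ++ r))).
  by rewrite /pr avg_swap -(avg_cat l d (fun s => (~~ hitU s)%:R)) addnC -El.
have -> : (d + n = d + (l + d))%N by lia.
rewrite Eb Ea -avgZr [X in X <= _]avg_cat; apply: le_avg => p pd.
rewrite avg_cat avg_swap -avgZ; apply: le_avg => r rd.
set g := pr l (fun c => ~~ hitU (c ++ r)).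
apply: (@le_trans _ _ (pr l (fun c => ~~ hitA (p ++ c) && ~~ hitU (c ++ r)))).
  rewrite le_eqVlt; apply/orP; left; apply/eqP/eq_avg => c cl.
  rewrite catA take_size_cat ?size_cat ?pd ?cl // -catA drop_size_cat //.
(* Prepending letters can only create hits, so the longest block has the least chance of avoiding
   them. *)
have gP j : (j <= l)%N -> g <= pr j (fun e => ~~ hitU (e ++ r)).
  move=> jl; rewrite /g -(subnK jl) /pr avg_cat.
  rewrite -[leRHS](avg_const Omega_gt0 (l - j)).
  apply: le_avg => e1 _; apply: le_avg => e2 _.
  rewrite -catA ler_nat; move: (@hitU_catr e1 (e2 ++ r)).
  by case: hitU => [->|_] //; case: hitU.
have := hit_correlation p gP.
have -> : pr l (fun e => hitA (p ++ e) && ~~ hitU (e ++ r)) =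
   g - pr l (fun c => ~~ hitA (p ++ c) && ~~ hitU (c ++ r)).
  rewrite -avgB; apply: eq_avg => e _.
  by case: hitA; case: hitU; rewrite /= ?subrr ?subr0.
rewrite (@prN l (fun c => hitA (p ++ c))).
lra.
Qed.

(** * Recursions for the probability of avoiding the events E_t *)

Definition pattern (s : seq Omega) : bool :=
  ~~ hitU (take n s) && ~~ hitA (take n (drop n s)).

(** For [k > 0], the [k] windows of length 2n span 2n + k - 1 letters, whence the word lengths
    [2 * n + k] below. *)
Fixpoint avoids (k : nat) (s : seq Omega) : bool :=
  if k is j.+1 then ~~ pattern s && avoids j (behead s) else true.

Lemma hitU_take w y :
  (size w < n)%N -> (n <= size y)%N -> ~~ hitA (take n y) ->
  hitU (take n (w ++ y)).
Proof.
move=> wn ny Uy; rewrite take_cat ltnNge (ltnW wn) /=; apply: hitU_cat.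
  rewrite -size_eq0 size_takel ?(leq_trans (leq_subr _ _)) //.
  by rewrite subn_eq0 -ltnNge.
have sy : size (take n y) == n by rewrite size_takel.
apply/existsP; exists (Tuple sy); rewrite /= Uy /=.
rewrite -{2}(subnK (ltnW wn)).
rewrite -[take _ y in X in prefix _ X](cat_take_drop (n - size w)).
by rewrite take_takel ?leq_addr // prefix_prefix.
Qed.

(** A window starting in [w] or at the start of [y] has a first half ending in a nonempty initial
    segment of a word of [U A], so it shows no pattern. These are the [size w + 1] windows
    dropped. *)
Lemma avoids_cat k w y :
  (size w < n)%N -> (n <= size y)%N -> ~~ hitA (take n y) ->
  avoids k (w ++ y) = avoids (k - (size w).+1) (behead y).
Proof.
move=> wn ny Uy; elim: w k wn => [|x w IH] [|k] wn //=.
- by rewrite subn1 /pattern (@hitU_take [::]).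
- by rewrite /pattern (@hitU_take (x :: w)) //= subSS IH // ltnW.
Qed.

Definition avoid_pr N k : R := pr N (avoids k).

Definition U_avoid_pr N d k : R :=
  pr N (fun s => ~~ hitA (take n s) && avoids k (drop d s)).

Lemma pattern_avoids_pr (B : pred (seq Omega)) d k M : (n <= M)%N ->
  pr (d + n + M)
     (fun s => B (take (d + n) s) &&
               (pattern (drop d s) && avoids k (drop d.+1 s)))
  = pr (d + n) (fun s => B s && ~~ hitU (drop d s)) * U_avoid_pr M 1 (k - n).
Proof.
move=> nM; rewrite /pr avg_cat -avgZr; apply: eq_avg => z zd.
rewrite -avgZ; apply: eq_avg => y yM.
have sz : size (drop d z) = n by rewrite size_drop zd addKn.
rewrite take_size_cat // -natrM mulnb -andbA -[d.+1]add1n -drop_drop drop1.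
have -> : drop d (z ++ y) = drop d z ++ y.
  by rewrite drop_cat zd -[ltnLHS]addn0 ltn_add2l n_gt0.
congr (_%:R); congr (nat_of_bool (_ && _)).
rewrite /pattern take_size_cat // drop_size_cat // drop1 -andbA; congr (_ && _).
case: (boolP (hitA (take n y))) => //= Uy.
(* Here [w] has n - 1 letters, so exactly [n] windows are free of patterns, whence [k - n]. *)
case Ez: (drop d z) sz => [|x w] /= sz; first by move: n_gt0; rewrite -sz.
by rewrite avoids_cat ?sz ?yM.
Qed.

Lemma avoid_pr_rec k M : (n <= M)%N ->
  avoid_pr (n + M) k.+1 =
  avoid_pr (n + M).-1 k - hitU_free_pr * U_avoid_pr M 1 (k - n).
Proof.
move=> nM; have := pattern_avoids_pr xpredT 0 k nM; rewrite !add0n => H.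
have -> : hitU_free_pr = pr n (fun s => true && ~~ hitU (drop 0 s)).
  by apply: eq_avg => s _; rewrite drop0.
rewrite -H /avoid_pr -(pr_drop R Omega_gt0 1 (n + M).-1 (avoids k)).
rewrite add1n prednK ?addn_gt0 ?n_gt0 //.
rewrite /pr -avgB; apply: eq_avg => s _; rewrite /= drop0 drop1.
by case: pattern; case: avoids; rewrite /= ?subrr ?subr0.
Qed.

Lemma U_avoid_pr_rec d k M : (n <= M)%N ->
  U_avoid_pr (d + n + M) d k.+1 >=
  U_avoid_pr (d + n + M) d.+1 k -
    hitA_free_pr * hitU_free_pr * U_avoid_pr M 1 (k - n).
Proof.
move=> nM; have H := pattern_avoids_pr (fun s => ~~ hitA (take n s)) d k nM.
apply: (@le_trans _ _ (U_avoid_pr (d + n + M) d.+1 k -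
  pr (d + n) (fun s => ~~ hitA (take n s) && ~~ hitU (drop d s)) *
    U_avoid_pr M 1 (k - n))).
  by rewrite lerD2l lerN2 ler_wpM2r ?pr_ge0 ?U_A_correlation.
rewrite -H -avgB; apply: le_avg => s _.
rewrite take_takel ?leq_addl // [avoids k.+1 _]/=.
rewrite -[behead _]drop1 drop_drop add1n.
by case: hitA; case: pattern; case: avoids; rewrite /= ?subrr ?subr0.
Qed.

(** By induction on [k]: the loss in [avoid_pr_rec], times [hitA_free_pr], equals the largest loss
    allowed by [U_avoid_pr_rec]. The offset [d] is general because each step raises it by one; the
    application takes d = 1. *)
Lemma U_avoid_pr_ge d k N : (2 * n + k <= N)%N ->
  hitA_free_pr * avoid_pr N k <= U_avoid_pr (d + N) d k.
Proof.
elim: k d N => [|k IH] d N Nk.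
  rewrite /avoid_pr /pr avg_const // mulr1 /hitA_free_pr.
  have EN : (d + N = n + (d + N - n))%N by lia.
  rewrite /U_avoid_pr EN -(pr_take R Omega_gt0 n (d + N - n)) -EN.
  by apply: le_avg => s _; rewrite /= andbT.
have [M EN] : exists M, N = (n + M)%N by exists (N - n)%N; lia.
have nM : (n <= M)%N by lia.
rewrite EN addnA avoid_pr_rec //.
apply: le_trans (U_avoid_pr_rec d k nM); rewrite mulrBr mulrA lerD2r.
have -> : (d + n + M = d.+1 + (n + M).-1)%N by lia.
by apply: IH; lia.
Qed.

Lemma avoid_pr_ge0 N k : 0 <= avoid_pr N k. Proof. exact: pr_ge0. Qed.

Lemma avoid_pr_0 N : avoid_pr N 0 = 1. Proof. exact: avg_const. Qed.

Lemma hitU_free_pr_ge0 : 0 <= hitU_free_pr. Proof. exact: pr_ge0. Qed.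

Lemma avoid_pr_decay k : (n <= k)%N ->
  avoid_pr (2 * n + k.+1) k.+1 <=
  avoid_pr (2 * n + k) k -
    hitU_free_pr * hitA_free_pr * avoid_pr (2 * n + (k - n)) (k - n).
Proof.
move=> nk; have -> : (2 * n + k.+1 = n + (n + k.+1))%N by lia.
rewrite avoid_pr_rec ?leq_addr //.
have -> : (n + (n + k.+1)).-1 = (2 * n + k)%N by lia.
rewrite lerD2l lerN2 -mulrA ler_wpM2l ?hitU_free_pr_ge0 //.
have -> : (n + k.+1 = 1 + (2 * n + (k - n)))%N by lia.
by apply: U_avoid_pr_ge.
Qed.
End Overlaps.

(** * Sequences with delayed decay *)

Lemma expr_mul_onem_le (R : realFieldType) (n : nat) (x : R) :
  0 <= x -> x ^+ n * (n.+1%:R - n%:R * x) <= 1.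
Proof.
move=> x0; elim: n => [|n IH]; first by rewrite expr0 mul0r subr0 mulr1.
(* Once the induction hypothesis is multiplied by [x], this product of two factors of equal sign is
   exactly the remaining gap. *)
have H : 0 <= (x ^+ n.+1 - 1) * (x - 1).
  have [x1|x1] := leP 1 x.
    by rewrite mulr_ge0 // subr_ge0 // exprn_ege1.
  by rewrite mulr_le0 // subr_le0 ?(ltW x1) // exprn_ile1 // ltW.
have {}IH : x * (x ^+ n * (n.+1%:R - n%:R * x)) <= x by rewrite ler_piMr.
move: H IH; rewrite !exprS -[n.+2%:R]natr1 -[n.+1%:R]natr1; nra.
Qed.

Lemma max_expr_mul_onem (R : realFieldType) (n : nat) (r : R) :
  (0 < n)%N -> 0 <= r ->
  r ^+ n * (1 - r) <= (n%:R / n.+1%:R) ^+ n.+1 / n%:R.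
Proof.
move=> n0 r0; have n0' : n%:R != 0 :> R by rewrite pnatr_eq0 -lt0n.
have n1' : n.+1%:R != 0 :> R by rewrite pnatr_eq0.
set t : R := n%:R / n.+1%:R.
have t0 : 0 < t by rewrite divr_gt0 ?ltr0n.
(* The maximum is at [r = t]; dividing by [t] moves it to 1. *)
have := expr_mul_onem_le n (divr_ge0 r0 (ltW t0)).
rewrite expr_div_n -mulrA [X in _ * X]mulrC mulrA.
rewrite ler_pdivrMr ?exprn_gt0 // mul1r.
have -> : n.+1%:R - n%:R * (r / t) = n.+1%:R * (1 - r).
  have E (a b : R) : a != 0 -> b != 0 -> b - a * (r / (a / b)) = b * (1 - r).
    by move=> a0 b0; field; rewrite a0 b0.
  exact: E.
move=> H; rewrite exprS -mulrA [_ / n%:R]mulrC mulrA.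
have -> : t / n%:R = n.+1%:R^-1 by rewrite /t mulrAC divff ?mul1r.
have -> : r ^+ n * (1 - r) = n.+1%:R^-1 * (r ^+ n * (n.+1%:R * (1 - r))).
  by rewrite mulrCA mulKf.
by rewrite ler_wpM2l ?invr_ge0.
Qed.

Lemma delayed_decay_bound (R : archiRealFieldType) (n : nat) (c : R)
    (F : nat -> R) :
  (0 < n)%N -> 0 <= c -> F 0%N = 1 -> (forall k, 0 <= F k) ->
  (forall k, (n <= k)%N -> F k.+1 <= F k - c * F (k - n)%N) ->
  c <= (n%:R / n.+1%:R) ^+ n.+1 / n%:R.
Proof.
move=> n0 c0 F0 Fge0 rec; rewrite leNgt; apply/negP => hc.
set c' := (X in X < _) in hc; pose del := c - c'.
have del0 : 0 < del by rewrite subr_gt0.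
have dec m : (n <= m)%N -> F m.+1 <= F m.
  by move=> nm; apply: le_trans (rec m nm) _; rewrite gerBl mulr_ge0.
have shrink k m : (n * k.+1 <= m)%N -> F m.+1 <= (1 - k%:R * del) * F m.
  elim: k m => [|k IH] m km; first by rewrite mul0r subr0 mul1r dec //; lia.
  set r := 1 - k%:R * del in IH.
  have -> : 1 - k.+1%:R * del = r - del by rewrite /r -natr1; ring.
  apply: le_trans (rec _ _) _; first by lia.
  (* A negative ratio bound at [m - 1] forces [F m = 0]. *)
  have [r0|r0] := ltP r 0.
    have Fm : F m = 0.
      apply: le_anti; rewrite Fge0 andbT.
      have -> : m = m.-1.+1 by lia.
      apply: le_trans (IH m.-1 _) _; first by lia.
      by rewrite mulr_le0_ge0 // ltW.
    by rewrite Fm mulr0 sub0r oppr_le0 mulr_ge0.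
  have pow j : (j <= n)%N -> F m <= r ^+ j * F (m - j)%N.
    elim: j => [|j IHj] jn; first by rewrite expr0 mul1r subn0.
    apply: le_trans (IHj (ltnW jn)) _; rewrite exprSr -mulrA.
    rewrite ler_wpM2l ?exprn_ge0 //.
    have -> : (m - j = (m - j.+1).+1)%N by lia.
    by apply: IH; lia.
  have r1 : r <= 1 by rewrite gerBl mulr_ge0 ?ler0n // ltW.
  have rn1 : r ^+ n <= 1 by rewrite exprn_ile1.
  have := max_expr_mul_onem n0 r0; rewrite -/c' => hr.
  (* As c = c' + del with c' >= r^n (1 - r) and r^n <= 1, c >= (1 - r + del) r^n; so the new ratio
     is at most r - del. *)
  have H : (1 - r + del) * F m <= c * F (m - n)%N.
    apply: (@le_trans _ _ ((1 - r + del) * (r ^+ n * F (m - n)%N))).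
      by rewrite ler_wpM2l ?pow // addr_ge0 ?subr_ge0 // ltW.
    rewrite mulrA ler_wpM2r //.
    have : del * r ^+ n <= del by rewrite ler_piMr // ltW.
    by rewrite /del in del0 *; nra.
  by move: H; nra.
(* If [F] vanished at a multiple of [n], the recursion would give a negative value; positivity makes
   a negative ratio contradictory. *)
have Fpos j : 0 < F (n * j)%N.
  elim: j => [|j IH]; first by rewrite muln0 F0.
  have cpos : 0 < c.
    by apply: le_lt_trans hc; rewrite divr_ge0 ?exprn_ge0 ?divr_ge0.
  have := rec (n * j.+1)%N (leq_pmulr _ _) => /(_ isT).
  have -> : (n * j.+1 - n = n * j)%N by rewrite mulnS addKn.
  have := Fge0 (n * j.+1).+1; have := mulr_gt0 cpos IH; lra.
have [k hk] : exists k, 1 < k%:R * del.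
  exists (Num.bound del^-1); rewrite -ltr_pdivrMr // div1r.
  by apply: archi_boundP; rewrite invr_ge0 ltW.
have := shrink k (n * k.+1)%N (leqnn _).
have := Fge0 (n * k.+1).+1; have := Fpos k.+1; nra.
Qed.

(** * The bound on the product of the two measures, and on [gamma] *)

Lemma mu_mul_U_le (R : realType) (n : nat) (Omega : finType)
    (A : {set n.-tuple Omega}) :
  (0 < n)%N -> (0 < #|Omega|)%N ->
  mu R A * mu R (U A) <= (n%:R / n.+1%:R) ^+ n.+1 / n%:R.
Proof.
move=> n0 O0.
have -> : mu R (U A) = hitA_free_pr R A.
  exact: esym (@pr_card R _ _ (U A) (fun u => ~~ hitA A u) (in_U A)).
have alpha_le : mu R A <= hitU_free_pr R A.
  pose A' := [set w : n.-tuple Omega | ~~ hitU A w].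
  rewrite /hitU_free_pr (@pr_card R _ _ A' (fun w => ~~ hitU A w)); last first.
    by move=> w; rewrite inE.
  rewrite ler_wpM2r ?invr_ge0 // ler_nat subset_leq_card //.
  by apply/fintype.subsetP => w wA; rewrite inE hitU_notin.
apply: (@le_trans _ _ (hitU_free_pr R A * hitA_free_pr R A)).
  by rewrite ler_wpM2r ?pr_ge0.
apply: (@delayed_decay_bound _ n _ (fun k => avoid_pr R A (2 * n + k) k)) => //.
- by rewrite mulr_ge0 ?pr_ge0.
- exact: avoid_pr_0.
- by move=> k; apply: avoid_pr_ge0.
- by move=> k; apply: avoid_pr_decay.
Qed.

Theorem theorem1p1 (R : realType) (n : nat) (alpha : R) :
  (1 <= n)%N -> 0 < alpha < 1 ->
  gamma alpha n <= (n%:R / (n%:R + 1)) ^+ n.+1 * (1 / (alpha * n%:R))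
  /\
  (forall (Omega : finType) (A : {set n.-tuple Omega}),
     (0 < #|Omega|)%N -> mu R A = alpha ->
     mu R (U A) <= (n%:R / (n%:R + 1)) ^+ n.+1 * (1 / (alpha * n%:R))).
Proof.
move=> n0 /andP[a0 _].
have H (Omega : finType) (A : {set n.-tuple Omega}) :
    (0 < #|Omega|)%N -> mu R A = alpha ->
    mu R (U A) <= (n%:R / (n%:R + 1)) ^+ n.+1 * (1 / (alpha * n%:R)).
  move=> O0 Aa; rewrite natr1 div1r invfM [alpha^-1 * _]mulrC mulrA.
  by rewrite ler_pdivlMr // mulrC -Aa mu_mul_U_le.
split=> //; rewrite /gamma; set S := [set x | _]%classic.
(* If no set has measure [alpha], the supremum is 0 by default and the bound is nonnegative. *)
have [->|/set0P S0] := eqVneq S set0.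
  by rewrite sup0 mulr_ge0 ?exprn_ge0 // ?divr_ge0 ?mulr_ge0 ?addr_ge0 // ltW.
by apply: ge_sup => // x [Omega [A [O0 Aa ->]]]; apply: H.
Qed.
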